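(* Let $P:\mathscr X\to\mathscr Y$ be continuous, let $\Lambda\subseteq\mathscr Y$, let $\bar x\in\mathscr X$ with $P(\bar x)\in\Lambda$, and suppose $\Lambda$ is closed near $P(\bar x)$. Suppose that the weak sufficient condition for metric subregularity (WSCMS) holds at $\bar x$, i.e., for all $(0,0)\neq(u,\xi)\in\widetilde{\mathcal L}(\bar x)$ there exist no unit vector $\zeta\in\mathscr Y$ and sequences $(u_k,v_k,\zeta_k)\to(u,0,\zeta)$ in $\mathscr X\times\mathscr Y\times\mathscr Y$ and $t_k\downarrow0$ satisfying $$0\in D^*P(\bar x;(u,\xi))(\zeta),\qquad \zeta\in N_\Lambda(P(\bar x);\xi),$$ $$\zeta_k\in\widehat N_\Lambda(s_k)\ \text{ with }\ s_k=P(\bar x+t_ku_k)-t_kv_k,\qquad P(\bar x+t_ku_k)\notin\Lambda\quad\text{for all }k,$$ $$\lim_{k\to\infty}\Big\langle\zeta_k,\frac{v_k}{\|v_k\|}\Big\rangle=1.$$ Then the set-valued map $G(x)=P(x)-\Lambda$ is metrically subregular at $(\bar x,0)$.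
   Context: $\mathscr X,\mathscr Y$ are finite-dimensional Hilbert spaces; $t_k\downarrow0$ means $t_k>0$ and $t_k\to0$. ''$\Lambda$ is closed near $P(\bar x)$'' means that $\Lambda\cap B$ is closed for some closed ball $B$ centred at $P(\bar x)$. For a set $\Omega$ and $\bar y\in\Omega$: - tangent cone: $T_\Omega(\bar y)=\{d:\exists t_k\downarrow0,\ d_k\to d \text{ with } \bar y+t_kd_k\in\Omega\ \forall k\}$; - regular (Fréchet) normal cone: $\widehat N_\Omega(\bar y)=\{\zeta:\limsup_{y\to\bar y,\,y\in\Omega}\langle\zeta,y-\bar y\rangle/\|y-\bar y\|\le0\}$, with $\widehat N_\Omega(y)=\emptyset$ if $y\notin\Omega$ (so $\zeta_k\in\widehat N_\Lambda(s_k)$ includes $s_k\in\Lambda$); - limiting normal cone in direction $d$: $N_\Omega(\bar y;d)=\{\zeta:\exists t_k\downarrow0,\ d_k\to d,\ \zeta_k\to\zeta \text{ with } \zeta_k\in\widehat N_\Omega(\bar y+t_kd_k)\ \forall k\}$. Graphical derivative: $DP(x)(u)=\{\xi:\exists t_k\downarrow0,\ u_k\to u \text{ with } \lim_k (P(x+t_ku_k)-P(x))/t_k=\xi\}$. Directional limiting coderivative: $D^*P(\bar x;(u,\xi))(\zeta)=\{\eta\in\mathscr X:(\eta,-\zeta)\in N_{\mathrm{gph}P}((\bar x,P(\bar x));(u,\xi))\}$, where $\mathrm{gph}P=\{(x,P(x)):x\in\mathscr X\}\subseteq\mathscr X\times\mathscr Y$. Extended linearized cone: $\widetilde{\mathcal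 L}(x)=\{(u,\xi)\in\mathscr X\times\mathscr Y:\xi\in DP(x)(u)\cap T_\Lambda(P(x))\}$. $G(x)=P(x)-\Lambda$ is metrically subregular at $(\bar x,0)$ (where $0\in G(\bar x)$) if there exist $\kappa\ge0$ and a neighborhood $U$ of $\bar x$ such that $d(x,G^{-1}(0))\le\kappa\, d(P(x),\Lambda)$ for all $x\in U$, where $G^{-1}(0)=\{x:P(x)\in\Lambda\}$ and $d(\cdot,C)$ is the distance to the set $C$. *)

(* Defs.v *)
From HB Require Import structures.
From mathcomp Require Import all_boot all_order all_algebra sesquilinear.
From mathcomp Require Import all_classical all_reals.
From mathcomp Require Import topology normedtype sequences.
From mathcomp Require Import ring lra.

Set Implicit Arguments.
Unset Strict Implicit.
Unset Printing Implicit Defensive.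

Import Order.TTheory GRing.Theory Num.Theory numFieldNormedType.Exports.

Local Open Scope classical_set_scope.
Local Open Scope ring_scope.

(* Real finite-dimensional Hilbert spaces: the topology and the norm of the
   normed module are those of the inner product. *)
HB.mixin Record NormedModule_hasInner (R : realType) V
    & NormedModule R V := {
  inner : {dot V for (@idfun R)} ;
  normr_inner : forall x : V, `|x| = Num.sqrt (inner x x)
}.

#[short(type="finHilbertType")]
HB.structure Definition FinHilbert (R : realType) :=
  {V of NormedModule_hasInner R V & NormedModule R V & Vector R V}.

Section CauchySchwarz.
Variables (R : realType) (V : lmodType R) (f : {dot V for (@idfun R)}).

Lemma dot_sym x y : f x y = f y x.
Proof. by rewrite hermC expr0 mul1r. Qed.

Lemma dot_ge0 x : 0 <= f x x.
Proof.
have [->|x0] := eqVneq x 0; first by rewrite linear0l.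
by rewrite ltW// neq0_dnorm_gt0.
Qed.

Lemma dot_eq0 x : f x x = 0 -> x = 0.
Proof.
move=> fx0; apply/eqP; apply: contraT => x0.
by have := @neq0_dnorm_gt0 _ _ _ f _ x0; rewrite fx0 ltxx.
Qed.

Lemma dot_Cauchy_Schwarz x y : f x y ^+ 2 <= f x x * f y y.
Proof.
have [->|y0] := eqVneq y 0; first by rewrite (linear0r f x) (linear0r f 0) expr0n mulr0.
have yy0 : 0 < f y y by exact: neq0_dnorm_gt0.
have := dot_ge0 (f y y *: x - f x y *: y).
rewrite !linearBl !linearBr !linearZl_LR !linearZr_LR /= (dot_sym y x) => h.
rewrite -subr_ge0 -(pmulr_rge0 _ yy0); move: h; congr (_ <= _); ring.
Qed.

Lemma dot_triangle x y :
  Num.sqrt (f (x + y) (x + y)) <= Num.sqrt (f x x) + Num.sqrt (f y y).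
Proof.
rewrite -(@ler_pXn2r _ 2) ?nnegrE ?addr_ge0 ?sqrtr_ge0//.
rewrite sqrrD !sqr_sqrtr ?dot_ge0// !linearDl !linearDr /= (dot_sym y x).
suff : f x y <= Num.sqrt (f x x) * Num.sqrt (f y y) by lra.
rewrite -sqrtrM ?dot_ge0// (le_trans (ler_norm _))// -sqrtr_sqr ler_wsqrtr//.
exact: dot_Cauchy_Schwarz.
Qed.

Lemma dot_sqrtZ (l : R) x :
  Num.sqrt (f (l *: x) (l *: x)) = `|l| * Num.sqrt (f x x).
Proof.
by rewrite linearZl_LR linearZr_LR /= mulrA -expr2 sqrtrM ?sqr_ge0// sqrtr_sqr.
Qed.

Lemma dot_sqrt_eq0 x : Num.sqrt (f x x) = 0 -> x = 0.
Proof.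
move/eqP; rewrite sqrtr_eq0 => h; apply: dot_eq0; apply/eqP.
by rewrite eq_le h dot_ge0.
Qed.

End CauchySchwarz.

(* Builds norm, topology and inner product from a bare inner product. *)
HB.factory Record Vector_hasInner (R : realType) V & Vector R V := {
  dot : {dot V for (@idfun R)}
}.

HB.builders Context R V & Vector_hasInner R V.

HB.instance Definition _ := @Lmodule_isNormed.Build R V
  (fun x => Num.sqrt (dot x x))
  (@dot_triangle _ _ dot) (@dot_sqrtZ _ _ dot) (@dot_sqrt_eq0 _ _ dot).

HB.instance Definition _ := @NormedModule_hasInner.Build R V dot (fun=> erefl).

HB.end.

(* The Hilbert product of X and Y. The library's canonical structures on
   X * Y carry the sup norm, hence the alias. *)
Definition hprod (R : realType) (X Y : finHilbertType R) : Type := (X * Y)%type.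

Section hprod.
Variables (R : realType) (X Y : finHilbertType R).

HB.instance Definition _ := Vector.copy (hprod X Y) (X * Y)%type.

Definition hprod_dot (p q : hprod X Y) : R :=
  inner p.1 q.1 + inner p.2 q.2.

Let hprod_dot_bilinear :
  bilinear_for (GRing.Scale.Law.clone _ _ *%R _)
    (GRing.Scale.Law.clone _ _ (@idfun R \; *%R) _) hprod_dot.
Proof.
split=> p a q r; rewrite /hprod_dot.
  by rewrite !linearPl /= mulrDr addrACA.
by rewrite !linearPr /= mulrDr addrACA.
Qed.

HB.instance Definition _ := bilinear_isBilinear.Build R _ _ _
  (GRing.Scale.Law.clone _ _ *%R _)
  (GRing.Scale.Law.clone _ _ (@idfun R \; *%R) _)
  hprod_dot hprod_dot_bilinear.

Let hprod_dot_sym (p q : hprod X Y) :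
  hprod_dot p q = (-1) ^+ false * idfun (hprod_dot q p).
Proof.
by rewrite expr0 mul1r /hprod_dot (dot_sym _ p.1) (dot_sym _ p.2).
Qed.

HB.instance Definition _ :=
  isHermitianSesquilinear.Build R (hprod X Y) false idfun hprod_dot
    hprod_dot_sym.

Let hprod_dot_gt0 (p : hprod X Y) : p != 0 -> 0 < hprod_dot p p.
Proof.
move=> p0; rewrite lt_neqAle addr_ge0 ?dot_ge0// andbT eq_sym.
apply: contra p0 => /eqP /[dup] + /eqP; rewrite /hprod_dot.
rewrite paddr_eq0 ?dot_ge0// => _ /andP[/eqP p1 /eqP p2]; apply/eqP.
by rewrite [p]surjective_pairing (dot_eq0 p1) (dot_eq0 p2).
Qed.

HB.instance Definition _ :=
  isDotProduct.Build R (hprod X Y) hprod_dot hprod_dot_gt0.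

HB.instance Definition _ := Vector_hasInner.Build R (hprod X Y) hprod_dot.

End hprod.

Section cones.
Variables (R : realType) (V : finHilbertType R).
Implicit Types (Omega : set V) (y d zeta : V).

Definition downto0 (t : R^nat) : Prop :=
  (forall k, 0 < t k) /\ t @ \oo --> (0 : R).

Definition tangent_cone Omega y : set V :=
  [set d | exists (t : R^nat) (d_ : V^nat),
    [/\ downto0 t, d_ @ \oo --> d & forall k, Omega (y + t k *: d_ k)]].

(* The punctured filter makes the limsup -oo at isolated points of Omega. *)
Definition regular_normal_cone Omega y : set V :=
  [set zeta | Omega y /\
    (limf_esup (fun z => (inner zeta (z - y) / `|z - y|)%:E)
               (within Omega y^') <= 0)%E].

Definition directional_normal_cone Omega y d : set V :=
  [set zeta | exists (t : R^nat) (d_ zeta_ : V^nat),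
    [/\ downto0 t, d_ @ \oo --> d, zeta_ @ \oo --> zeta &
        forall k, regular_normal_cone Omega (y + t k *: d_ k) (zeta_ k)]].

End cones.

Section derivatives.
Variables (R : realType) (X Y : finHilbertType R) (P : X -> Y).

Definition graphical_derivative (x u : X) : set Y :=
  [set xi | exists (t : R^nat) (u_ : X^nat),
    [/\ downto0 t, u_ @ \oo --> u &
        (fun k => (t k)^-1 *: (P (x + t k *: u_ k) - P x)) @ \oo --> xi]].

Definition gph : set (hprod X Y) := [set p | p.2 = P p.1].

Definition directional_coderivative (x u : X) (xi zeta : Y) : set X :=
  [set eta | directional_normal_cone gph
    ((x, P x) : hprod X Y) ((u, xi) : hprod X Y) ((eta, - zeta) : hprod X Y)].

Variable Lambda : set Y.

Definition ext_linearized_cone (x : X) : set (X * Y) :=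
  [set p | graphical_derivative x p.1 p.2 /\ tangent_cone Lambda (P x) p.2].

(* The weak sufficient condition for metric subregularity. *)
Definition wscms (x : X) : Prop :=
  forall (u : X) (xi : Y), (u, xi) <> (0, 0) ->
  ext_linearized_cone x (u, xi) ->
  ~ exists (zeta : Y) (u_ : X^nat) (v_ zeta_ : Y^nat) (t : R^nat),
    [/\ `|zeta| = 1,
        [/\ u_ @ \oo --> u, v_ @ \oo --> (0 : Y), zeta_ @ \oo --> zeta &
            downto0 t],
        directional_coderivative x u xi zeta 0 /\
          directional_normal_cone Lambda (P x) xi zeta,
        forall k,
          regular_normal_cone Lambda (P (x + t k *: u_ k) - t k *: v_ k)
            (zeta_ k) /\
          ~ Lambda (P (x + t k *: u_ k)) &
        (fun k => inner (zeta_ k) (`|v_ k|^-1 *: v_ k)) @ \oo --> (1 : R)].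

(* Metric subregularity of the set-valued map x |-> P x - Lambda at (x, 0);
   the distance from 0 to P z - Lambda is the one from P z to Lambda. *)
Definition metrically_subregular (x : X) : Prop :=
  exists2 kappa : R, 0 <= kappa &
    \forall z \near x,
      (edist_inf (P @^-1` Lambda) z <= kappa%:E * edist_inf Lambda (P z))%E.

End derivatives.

Definition closed_near (R : realType) (Y : finHilbertType R)
    (Lambda : set Y) (y : Y) : Prop :=
  exists2 r : R, 0 < r & closed (Lambda `&` closed_ball y r).

(* Main.v *)
Require Import Defs.
From HB Require Import structures.
From mathcomp Require Import all_boot all_order all_algebra.
From mathcomp Require Import all_classical all_reals topology normedtype sequences.
From mathcomp Require Import ereal derive realfun ring lra.

Set Implicit Arguments.
Unset Strict Implicit.
Unset Printing Implicit Defensive.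

Import Order.TTheory GRing.Theory Num.Theory numFieldNormedType.Exports.
Import VectorInternalTheory.

Local Open Scope classical_set_scope.
Local Open Scope ring_scope.

(* Suppose metric subregularity fails. Then for every kappa there are z near xbar
   and s0 in Lambda such that rho := kappa |P z - s0| is less than the distance
   from z to the solution set. A minimizer (x', s') of
   |P x - s| + |x - z|^2 / (kappa rho) over a compact neighbourhood, with s in
   Lambda, stays within rho of z, so P x' is not in Lambda, and its residual is
   at most (2 / kappa) |x' - xbar|. Optimality in s makes the unit residual
   direction zeta normal to Lambda at s'; optimality in x makes (eta, - zeta)
   normal to the graph of P, with |eta| <= 2 / kappa. The quadratic penalty keeps
   the objective smooth at x' = z. Letting kappa tend to infinity and scaling by
   t = |(x', P x') - (xbar, P xbar)| (rather than |x' - xbar|, as the difference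
   quotients of P may be unbounded) yields, along a subsequence, a direction
   (u, xi) <> (0, 0) that violates the weak sufficient condition. *)

(** * Compactness in finite dimension *)

Section finite_dimension.
Variables (R : realType) (V : finHilbertType R).

Lemma r2v_continuous : continuous (r2v : 'rV[R]_(dim V) -> V).
Proof.
move=> a.
have -> : (r2v : 'rV[R]_(dim V) -> V) =
    (fun a => \sum_i a 0 i *: r2v (delta_mx 0 i)).
  by apply/funext => b; rewrite [in LHS](row_sum_delta b) linear_sum;
     apply: eq_bigr => i _; rewrite linearZ.
apply: cvg_big => [||i _]; [exact: add_continuous|exact: nbhs_filter|].
apply: cvgZr_tmp.
  exact: nbhs_filter.
exact: (@coord_continuous _ _ _ 0 i a).
Qed.

(** On the compact unit sphere of coordinate vectors, the continuous function [|r2v a|] attains a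
    positive minimum, whose inverse serves as [C]. *)
Lemma v2r_bounded : exists2 C : R, 0 <= C & forall x : V, `|v2r x| <= C * `|x|.
Proof.
have [[a0 a01]|S0] :=
  pselect ([set a : 'rV[R]_(dim V) | `|a| = 1] !=set0); last first.
  (* An empty unit sphere forces every coordinate vector to vanish. *)
  exists 0 => // x; rewrite mul0r.
  have [->|x0] := eqVneq (v2r x) 0; first by rewrite normr0.
  exfalso; apply: S0; exists (`|v2r x|^-1 *: v2r x).
  by rewrite /= normrZ normrV ?unitfE ?normr_eq0// normr_id mulVf// normr_eq0.
have cS : compact [set a : 'rV[R]_(dim V) | `|a| = 1].
  apply: bounded_closed_compact.
    by exists 1; split => // x x1 a /= ->; exact: ltW.
  rewrite (_ : [set _ | _] = (fun a => `|a|) @^-1` [set (1 : R)])//.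
  by apply: closed_comp => [? _|]; [exact: norm_continuous|exact: closed_eq].
have cf : continuous (fun a : 'rV[R]_(dim V) => `|r2v a : V|).
  move=> a; apply: continuous_comp; first exact: r2v_continuous.
  exact: norm_continuous.
have [c /set_mem/= c1 cmin] :=
  compact_EVT_min (ex_intro _ a0 a01) cS (continuous_subspaceT cf).
have c0 : 0 < `|r2v c : V|.
  rewrite normr_gt0; apply/eqP => rc0.
  have : v2r (r2v c : V) = 0 by rewrite rc0 linear0.
  by rewrite r2vK => c0; move: c1; rewrite c0 normr0 => /esym/eqP; rewrite oner_eq0.
exists (`|r2v c : V|^-1); first by rewrite invr_ge0.
move=> x; have [->|x0] := eqVneq (v2r x) 0.
  by rewrite normr0 mulr_ge0 // invr_ge0.
rewrite ler_pdivlMl//.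
have nx : 0 < `|v2r x| by rewrite normr_gt0.
have := cmin (`|v2r x|^-1 *: v2r x).
rewrite inE/= linearZ/= v2rK !normrZ normrV ?unitfE ?gt_eqF//.
rewrite normr_id mulVf ?gt_eqF//.
by move=> /(_ erefl); rewrite ler_pdivlMl // mulrC.
Qed.

Lemma finHilbert_compact (A : set V) : bounded_set A -> closed A -> compact A.
Proof.
move=> [M [Mreal AM]] cA.
have -> : A = r2v @` (r2v @^-1` A).
  apply/seteqP; split => [x Ax|_ [a Aa <-]//].
  by exists (v2r x) => //=; rewrite v2rK.
apply: continuous_compact.
  by apply: continuous_subspaceT; exact: r2v_continuous.
apply: bounded_closed_compact.
  have [C C0 hC] := v2r_bounded.
  exists (C * (`|M| + 1)); split => [|x Cx a /= Aa]; first exact: num_real.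
  rewrite -(r2vK a) (le_trans (hC _))// (le_trans _ (ltW Cx))// ler_wpM2l//.
  by apply: AM => //; rewrite (le_lt_trans (ler_norm _))// ltrDl.
by apply: closed_comp => // a _; exact: r2v_continuous.
Qed.

(** The bound [n <= f n] replaces strict monotonicity: it already makes [f] tend to infinity, which
    is all that limits along [f] require. *)
Lemma finHilbert_subsequence (x : V^nat) (M : R) : (forall k, `|x k| <= M) ->
  exists (f : nat -> nat) (l : V), (forall n, (n <= f n)%N) /\ x \o f @ \oo --> l.
Proof.
move=> xM.
have cB : compact (closed_ball_ (fun z => `|z|) (0 : V) M).
  apply: finHilbert_compact; last exact: closed_closed_ball_.
  exists M; split => [|y My z]; first exact: num_real.
  by rewrite /closed_ball_/= sub0r normrN => zM; rewrite (le_trans zM)// ltW.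
have [l [_ xl]] :
    closed_ball_ (fun z => `|z|) (0 : V) M `&` cluster (x @ \oo) !=set0.
  by apply: cB; exists 0%N => // k _; rewrite /closed_ball_/= sub0r normrN.
have /choice[f fP] n : exists k, (n <= k)%N /\ `|l - x k| < n.+1%:R^-1.
  have [||y [[k /= nk <-] lk]] :=
    xl (x @` [set k | (n <= k)%N]) (ball l n.+1%:R^-1).
  - by exists n => // k /= nk; exists k.
  - by apply: nbhsx_ballx; rewrite invr_gt0.
  - by exists k; split => //; move: lk; rewrite -ball_normE.
exists f, l; split => [n|]; first exact: (fP n).1.
apply/cvgrPdist_lt => _/posnumP[e]; near=> n.
rewrite (lt_trans (fP n).2)//.
near: n; exact: near_infty_natSinv_lt.
Unshelve. all: by end_near.
Qed.

End finite_dimension.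

(** * Norm identities from the inner product *)

Section inner_product.
Variables (R : realType) (V : finHilbertType R).
Implicit Types x y : V.

Lemma inner_normr x : inner x x = `|x| ^+ 2.
Proof. by rewrite normr_inner sqr_sqrtr ?dot_ge0. Qed.

Lemma normrD_sqr x y : `|x + y| ^+ 2 = `|x| ^+ 2 + 2 * inner x y + `|y| ^+ 2.
Proof.
rewrite -!inner_normr !linearDl !linearDr /= (dot_sym _ y x); ring.
Qed.

Lemma normr_normalize x : x != 0 -> `| `|x|^-1 *: x| = 1.
Proof. by move=> x0; rewrite normrZ normfV normr_id mulVf ?normr_eq0. Qed.

(* Concavity of the square root, applied to [`|x + y| ^+ 2]. *)
Lemma normrD_quadratic x y : x != 0 ->
  `|x + y| <= `|x| + inner (`|x|^-1 *: x) y + (2 * `|x|)^-1 * `|y| ^+ 2.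
Proof.
rewrite -normr_gt0 => x0; rewrite linearZl_LR /=.
have := normrD_sqr x y.
move: (`|x + y|) (normr_ge0 (x + y)) => a a0.
set n := `|x| in x0 *; set i := inner x y => h.
have -> : n + n^-1 * i + (2 * n)^-1 * `|y| ^+ 2 = (n ^+ 2 + a ^+ 2) / (2 * n).
  by rewrite h; field; rewrite gt_eqF.
rewrite ler_pdivlMr ?mulr_gt0// -subr_ge0.
have -> : n ^+ 2 + a ^+ 2 - a * (2 * n) = (n - a) ^+ 2 by ring.
exact: sqr_ge0.
Qed.

End inner_product.

(** * Norm and convergence in the Hilbert product *)

Section product_norm.
Variables (R : realType) (X Y : finHilbertType R).
Implicit Types p : hprod X Y.

Lemma hprod_innerE p q : inner p q = inner p.1 q.1 + inner p.2 q.2.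
Proof. by []. Qed.

Lemma hprod_normr_sqr p : `|p| ^+ 2 = `|p.1| ^+ 2 + `|p.2| ^+ 2.
Proof. by rewrite -!inner_normr. Qed.

Lemma hprod_normr1 p : `|p.1| <= `|p|.
Proof.
by rewrite -(@ler_pXn2r _ 2) ?nnegrE// hprod_normr_sqr lerDl sqr_ge0.
Qed.

Lemma hprod_normr2 p : `|p.2| <= `|p|.
Proof.
by rewrite -(@ler_pXn2r _ 2) ?nnegrE// hprod_normr_sqr lerDr sqr_ge0.
Qed.

Lemma hprod_normr_le p : `|p| <= `|p.1| + `|p.2|.
Proof.
rewrite -(@ler_pXn2r _ 2) ?nnegrE ?addr_ge0// hprod_normr_sqr.
by have := normr_ge0 p.1; have := normr_ge0 p.2; nra.
Qed.

(** The topology of [hprod] is that of its Euclidean norm, so convergence passes between a pair and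
    its components through the norm bounds above. *)
Lemma cvg_hprod1 T (F : set_system T) (f : T -> hprod X Y) p : Filter F ->
  f @ F --> p -> (fun t => (f t).1) @ F --> p.1.
Proof.
move=> FF /cvgrPdist_lt fp; apply/cvgrPdist_lt => e /fp.
by apply: filterS => t; apply: le_lt_trans (hprod_normr1 (p - f t)).
Qed.

Lemma cvg_hprod2 T (F : set_system T) (f : T -> hprod X Y) p : Filter F ->
  f @ F --> p -> (fun t => (f t).2) @ F --> p.2.
Proof.
move=> FF /cvgrPdist_lt fp; apply/cvgrPdist_lt => e /fp.
by apply: filterS => t; apply: le_lt_trans (hprod_normr2 (p - f t)).
Qed.

Lemma cvg_hprod T (F : set_system T) (f : T -> X) (g : T -> Y) x y : Filter F ->
  f @ F --> x -> g @ F --> y ->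
  (fun t => (f t, g t) : hprod X Y) @ F --> ((x, y) : hprod X Y).
Proof.
move=> FF /cvgrPdist_lt fx /cvgrPdist_lt gy; apply/cvgrPdist_lt => e e0.
have e2 : 0 < e / 2 by rewrite divr_gt0.
move: (fx _ e2) (gy _ e2); apply: filterS2 => t ft gt.
rewrite (le_lt_trans (hprod_normr_le _))//= (splitr e) ltrD//.
Qed.

End product_norm.

(** * Proximal normals and optimality conditions *)

Section proximal_normals.
Variables (R : realType).

(** Divided by [|z - y|], the quadratic bound becomes [C * |z - y|], which vanishes in the limit. *)
Lemma proximal_regular_normal (V : finHilbertType R) (Omega : set V) (y zeta : V)
    (C : R) :
  Omega y ->
  (\forall z \near y, Omega z -> inner zeta (z - y) <= C * `|z - y| ^+ 2) ->
  regular_normal_cone Omega y zeta.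
Proof.
move=> Oy nearC; split => //; apply/lee_addgt0Pr => e e0; rewrite add0e.
(* The limsup is an infimum of suprema over members of the filter. Since [Q] is a member, the limsup
   is at most [e]. *)
pose Q := [set z | inner zeta (z - y) / `|z - y| <= e].
apply: (@le_trans _ _ (ereal_sup
    ((fun z => (inner zeta (z - y) / `|z - y|)%:E) @` Q))); last first.
  by apply: ge_ereal_sup => _ [z Qz <-]; rewrite lee_fin; exact: Qz.
apply: ereal_inf_lbound; exists Q => //.
have C1 : 0 < `|C| + 1 by rewrite ltr_wpDl.
have eC : 0 < e / (`|C| + 1) by rewrite divr_gt0.
change (\forall z \near y, z != y -> Omega z -> Q z).
near=> z => zy Oz; rewrite /Q/=.
have zy0 : 0 < `|z - y| by rewrite normr_gt0 subr_eq0.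
rewrite ler_pdivrMr//.
have : inner zeta (z - y) <= C * `|z - y| ^+ 2 by move: Oz; near: z.
move=> /le_trans; apply; rewrite expr2 mulrA ler_pM2r//.
have : `|z - y| <= e / (`|C| + 1).
  near: z; have := nbhsx_ballx y _ eC; apply: filterS => z.
  by rewrite -ball_normE /= distrC => /ltW.
rewrite ler_pdivlMr// mulrC => /(le_trans _); apply.
by rewrite ler_pM2r// (le_trans (ler_norm _))// lerDl.
Unshelve. all: by end_near.
Qed.

Lemma projection_regular_normal (Y : finHilbertType R) (Lambda : set Y) (y s : Y) :
  Lambda s -> (\forall s' \near s, Lambda s' -> `|y - s| <= `|y - s'|) ->
  regular_normal_cone Lambda s (`|y - s|^-1 *: (y - s)).
Proof.
move=> Ls near_min.
(* The constant comes from expanding the square of [|(y - s) - (s' - s)|]. If [y = s], the inverse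
   of 0 is 0, and both the normal and the constant vanish. *)
apply: (@proximal_regular_normal _ _ _ _ (`|y - s|^-1 / 2)) => //.
apply: filterS near_min => s' min_s /min_s {min_s} le_s.
rewrite linearZl_LR /= -mulrA ler_wpM2l ?invr_ge0//.
have := normrD_sqr (y - s) (- (s' - s)).
have -> : y - s - (s' - s) = y - s' by rewrite opprB addrA subrK.
rewrite linearNr /= normrN => h.
have : `|y - s| ^+ 2 <= `|y - s'| ^+ 2 by rewrite lerXn2r ?nnegrE.
rewrite h; lra.
Qed.

(** On the graph the objective is a function of the pair [(x', y')], smooth near [(x, P x)] because
    [P x != s]. Minus its gradient is the stated vector; [k] and [|c|] bound the second-order
    terms. *)
Lemma graph_regular_normal (X Y : finHilbertType R) (P : X -> Y) (x z : X) (s : Y)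
    (c : R) :
  P x != s ->
  (\forall x' \near x,
     `|P x - s| + c * `|x - z| ^+ 2 <= `|P x' - s| + c * `|x' - z| ^+ 2) ->
  regular_normal_cone (gph P) ((x, P x) : hprod X Y)
    ((- (2 * c) *: (x - z), - (`|P x - s|^-1 *: (P x - s))) : hprod X Y).
Proof.
rewrite -subr_eq0 => Ps near_min; set k := (2 * `|P x - s|)^-1.
apply: (@proximal_regular_normal _ _ _ _ (k + `|c|)) => //.
have : \forall p \near ((x, P x) : hprod X Y),
   `|P x - s| + c * `|x - z| ^+ 2 <= `|P p.1 - s| + c * `|p.1 - z| ^+ 2.
  have := @cvg_hprod1 _ X Y _ (nbhs ((x, P x) : hprod X Y)) id _
    (nbhs_filter _) cvg_id.
  by move=> /(_ _ near_min).
apply: filterS => -[x' y'] /= min_x; rewrite /gph/= => ->.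
have h1 := normrD_quadratic (P x' - P x) Ps.
have h2 := normrD_sqr (x - z) (x' - x).
have k0 : 0 <= k by rewrite invr_ge0 mulr_ge0.
have e1 : P x' - s = P x - s + (P x' - P x) by rewrite [RHS]addrC addrA subrK.
have e2 : x' - z = x - z + (x' - x) by rewrite [RHS]addrC addrA subrK.
move: min_x; rewrite {}e1 {}e2 {}h2 => min_x.
rewrite hprod_normr_sqr hprod_innerE /= linearZl_LR !linearNl /=.
have := mulr_ge0 k0 (sqr_ge0 `|x' - x|).
have := mulr_ge0 (normr_ge0 c) (sqr_ge0 `|P x' - P x|).
have := ler_wpM2r (sqr_ge0 `|x' - x|) (ler_norm c).
move: h1 min_x; rewrite -/k.
lra.
Qed.

End proximal_normals.

(** * Distances to sets *)

Lemma near_normB_le (R : realType) (V : normedModType R) (x y : V) (e : R) :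
  `|x - y| < e -> \forall y' \near y, `|x - y'| <= e.
Proof.
move=> xye; apply: (@cvgr_norm_le _ _ _ _ _ (fun y' => x - y') (x - y)) => //.
by apply: cvgB; [exact: cvg_cst|exact: cvg_id].
Qed.

Lemma edist_normr (R : realType) (V : normedModType R) (x y : V) :
  edist (x, y) = `|x - y|%:E.
Proof.
apply/eqP; rewrite eq_le; apply/andP; split.
  apply/lee_addgt0Pr => e e0; apply: edist_fin => /=; first by rewrite ltr_wpDl.
  by rewrite -ball_normE /= ltrDl.
apply: le_ereal_inf_tmp => _ [r [_ xy] <-]; rewrite lee_fin.
by move: xy; rewrite -ball_normE => /ltW.
Qed.

(** If each [b] had some [a] within [kappa * |y - b|] of [x], the infimum over [b] would give the
    negated inequality. *)
Lemma edist_inf_gt_ex (R : realType) (U V : normedModType R) (A : set U)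
    (B : set V) (x : U) (y : V) (kappa : R) :
  0 < kappa -> ~ (edist_inf A x <= kappa%:E * edist_inf B y)%E ->
  exists2 b, B b & forall a, A a -> kappa * `|y - b| < `|x - a|.
Proof.
move=> kappa0; apply: contra_notP => noB.
rewrite -lee_pdivrMl//; apply: le_ereal_inf_tmp => _ [b Bb <-].
rewrite lee_pdivrMl// edist_normr.
have [a Aa xa] : exists2 a, A a & `|x - a| <= kappa * `|y - b|.
  apply: contrapT => noA; apply: noB; exists b => // a Aa.
  by rewrite ltNge; apply/negP => xa; apply: noA; exists a.
apply: (@le_trans _ _ (edist (x, a))).
  by apply: ereal_inf_lbound; exists a.
by rewrite edist_normr -EFinM lee_fin.
Qed.

(** * Penalized minimization and approximate critical points *)

Section approximate_solutions.
Variables (R : realType) (X Y : finHilbertType R) (P : X -> Y) (Lambda : set Y).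

Lemma penalized_minimizer (x z : X) (y : Y) (r rho c : R) : continuous P ->
  0 < rho -> 0 < r ->
  closed (Lambda `&` closed_ball y r) ->
  (Lambda `&` closed_ball y r) !=set0 ->
  exists x' s', [/\ `|x - x'| <= rho, Lambda s', `|y - s'| <= r &
    forall x0 s0, `|x - x0| <= rho -> Lambda s0 -> `|y - s0| <= r ->
      `|P x' - s'| + c * `|x' - z| ^+ 2 <= `|P x0 - s0| + c * `|x0 - z| ^+ 2].
Proof.
move=> cP rho0 r0 cL [s Ls].
have bounded_closed_ball (V : finHilbertType R) (v : V) e : 0 < e ->
    bounded_set (closed_ball v e).
  move=> e0; exists (`|v| + e); split => [|M vM w]; first exact: num_real.
  rewrite closed_ballE//= /closed_ball_/= => vw.
  rewrite (le_trans _ (ltW vM))// -(subKr v w) (le_trans (ler_normB _ _))//.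
  by rewrite lerD2l.
have cK : compact (closed_ball x rho `*` (Lambda `&` closed_ball y r)).
  apply: compact_setX; apply: finHilbert_compact => //.
  - exact: bounded_closed_ball.
  - exact: closed_ball_closed.
  - have [M [Mreal yM]] := bounded_closed_ball _ y _ r0.
    by exists M; split => // N /yM yN w [_ /yN].
pose f (p : X * Y) := `|P p.1 - p.2| + c * `|p.1 - z| ^+ 2.
have cf : continuous f.
  move=> p; apply: cvgD.
    apply: cvg_norm; apply: cvgB; last exact: cvg_snd.
    by apply: continuous_comp; [exact: cvg_fst|exact: cP].
  apply: cvgM; first exact: cvg_cst.
  apply: (@continuous_comp _ _ _ (fun p : X * Y => `|p.1 - z|)
    (fun a => a ^+ 2)); last exact: exprn_continuous.
  by apply: cvg_norm; apply: cvgB; [exact: cvg_fst|exact: cvg_cst].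
have [] := @compact_EVT_min _ _ f _ _ cK (continuous_subspaceT cf).
  by exists (x, s); split => //=; exact: closed_ballxx.
move=> [x' s'] /set_mem/= [/=].
rewrite !closed_ballE// /closed_ball_/= => xx' [Ls' ys'] fmin.
exists x', s'; split => // x0 s0 xx0 Ls0 ys0.
by have := fmin (x0, s0); apply; rewrite inE.
Qed.

Lemma not_metrically_subregular_near (x : X) (kappa e : R) :
  0 < kappa -> 0 < e -> ~ metrically_subregular P Lambda x ->
  exists z s, [/\ `|x - z| < e, Lambda s &
    forall w, Lambda (P w) -> kappa * `|P z - s| < `|z - w|].
Proof.
move=> k0 e0 nsub.
have [z xz nz] : exists2 z, `|x - z| < e &
   ~ (edist_inf (P @^-1` Lambda) z <= kappa%:E * edist_inf Lambda (P z))%E.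
  apply: contrapT => noz; apply: nsub; exists kappa; first exact: ltW.
  have := nbhsx_ballx x e e0; apply: filterS => z; rewrite -ball_normE /= => xz.
  by apply: contrapT => nz; apply: noz; exists z.
by have [s Ls sP] := edist_inf_gt_ex k0 nz; exists z, s; split.
Qed.

Lemma approximate_critical_point (x : X) (e : R) : continuous P ->
  Lambda (P x) -> closed_near Lambda (P x) -> 0 < e ->
  ~ metrically_subregular P Lambda x ->
  exists x' s' eta, let zeta := `|P x' - s'|^-1 *: (P x' - s') in
    [/\ `|x' - x| < e, ~ Lambda (P x'), `|P x' - s'| <= e * `|x' - x|,
      `|eta| <= e &
      regular_normal_cone Lambda s' zeta /\
      regular_normal_cone (gph P) ((x', P x') : hprod X Y)
        ((eta, - zeta) : hprod X Y)].
Proof.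
move=> cP LPx [r r0 cL] e0 nsub.
have [d d0 dP] : exists2 d, 0 < d & forall w, `|x - w| < d -> `|P x - P w| < r / 2.
  have /cvgrPdist_lt/(_ (r / 2)) : P w @[w --> x] --> P x by exact: cP.
  rewrite divr_gt0// => /(_ isT) /nbhs_ballP[d /= d0 dP].
  by exists d => // w xw; apply: dP; rewrite -ball_normE.
(* This choice gives both [2 / kappa <= e] and [kappa >= 1]. *)
pose kappa := 1 + 2 / e.
have e1 : 0 < 2 / e by rewrite divr_gt0.
have k1 : 1 <= kappa by rewrite lerDl ltW.
have k0 : 0 < kappa by lra.
have ke : 2 / kappa <= e.
  by rewrite ler_pdivrMr// mulrDr mulr1 mulrCA divff ?gt_eqF//; lra.
(* As [x'] will satisfy [|x - x'| < 2 * |x - z|], the bounds [e / 2] and [d / 2] put it within [e]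
   and [d] of [x]. The bound [r / 2] exceeds [m] and keeps [s0] in the ball of radius [r]. *)
have [|z [s0 [xz Ls0 sP]]] := @not_metrically_subregular_near x kappa
    (Num.min (Num.min (e / 2) (d / 2)) (r / 2)) k0 _ nsub.
  by rewrite !lt_min !divr_gt0.
move: xz; rewrite !lt_min => /andP[/andP[xze xzd] xzr].
set m := `|P z - s0| in sP.
have m0 : 0 < m.
  rewrite normr_gt0 subr_eq0; apply/eqP => Pzs.
  have := sP z; rewrite Pzs => /(_ Ls0).
  by rewrite /m Pzs !subrr !normr0 mulr0 ltxx.
(* The point [x] is itself a solution, so [sP] applies to it. *)
have mD : kappa * m < `|x - z| by rewrite (distrC x); exact: sP.
have m_le : m <= kappa * m by rewrite ler_peMl// ltW.
pose rho := kappa * m; rewrite -/rho in mD m_le.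
have rho0 : 0 < rho by rewrite mulr_gt0.
(* The weight [c] makes the penalty at distance [rho] from [z] equal to [m], the objective value at
   [(z, s0)]. *)
have [c c0 [crho crho1]] :
    exists2 c, 0 < c & c * rho ^+ 2 = m /\ c * rho = kappa^-1.
  exists (m / rho ^+ 2); first by rewrite divr_gt0// exprn_gt0.
  rewrite divfK ?gt_eqF ?exprn_gt0//; split => //.
  by rewrite /rho; field; rewrite !gt_eqF.
have Pxs0 : `|P x - s0| <= r.
  rewrite (le_trans (ler_distD (P z) _ _))//.
  have := dP z; rewrite -/m; lra.
have [|x' [s' [xx' Ls' ys' min']]] :=
    @penalized_minimizer x z (P x) r d c cP d0 r0 cL.
  by exists (P x); split => //; exact: closed_ballxx.
set w := P x' - s'; set a := `|x' - z|.
have wa : `|w| + c * a ^+ 2 <= m.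
  have := min' z s0; rewrite subrr normr0 expr0n mulr0 addr0; apply => //; lra.
have a0 : 0 <= a := normr_ge0 _.
have rho_ge0 := ltW rho0.
have a_le : a <= rho.
  rewrite -(@ler_pXn2r _ 2) ?nnegrE// -(ler_pM2l c0) crho.
  by have := normr_ge0 w; lra.
have NLPx' : ~ Lambda (P x').
  by move=> /sP; rewrite -/rho distrC -/a ltNge a_le.
have xx'le : `|x - x'| <= `|x - z| + a.
  by rewrite /a (distrC x') ler_distD.
(* With [rho < |x - z|] this yields [rho - a <= |x' - x|], making the residual bound relative to
   [|x' - x|]. *)
have xz_le : `|x - z| <= `|x' - x| + a.
  by rewrite /a (distrC x' x) ler_distD.
have w_le : `|w| <= 2 / kappa * `|x' - x|.
  (* since [m = c * rho ^+ 2] and [c * rho = kappa^-1], the residual is at most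
     [c * (rho - a) * (rho + a) <= 2 / kappa * (rho - a)] *)
  have : `|w| <= c * (rho - a) * (rho + a).
    rewrite (_ : c * _ * _ = m - c * a ^+ 2); first lra.
    by rewrite -crho; ring.
  move=> /le_trans; apply.
  apply: (@le_trans _ _ (2 / kappa * (rho - a))); last first.
    by rewrite ler_wpM2l ?divr_ge0 ?(ltW k0)//; lra.
  rewrite -crho1.
  have : 0 <= c * ((rho - a) * (rho - a)).
    by rewrite mulr_ge0 ?(ltW c0)// -expr2 sqr_ge0.
  nra.
have xx'_lt : `|x' - x| < d /\ `|x' - x| < e by rewrite distrC; split; lra.
have ww : `|w| <= m by have := mulr_ge0 (ltW c0) (sqr_ge0 a); lra.
(* Both ball constraints are strict at [(x', s')], so the minimizer is a local one without them, as
   the optimality conditions require. *)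
have near_x : \forall x0 \near x', `|x - x0| <= d.
  by apply: near_normB_le; rewrite distrC; exact: xx'_lt.1.
have near_s : \forall s \near s', `|P x - s| <= r.
  apply: near_normB_le; have := ler_distD (P x') (P x) s'.
  by have := dP x'; rewrite (distrC x) -/w => /(_ xx'_lt.1); lra.
exists x', s', (- (2 * c) *: (x' - z)); split => //.
- exact: xx'_lt.2.
- by rewrite (le_trans w_le)// ler_wpM2r.
(* Here [|eta| = 2 * c * a <= 2 * c * rho = 2 / kappa <= e]. *)
- rewrite normrZ normrN ger0_norm ?mulr_ge0 ?(ltW c0)// -/a.
  apply: le_trans ke.
  by rewrite -crho1 mulrA ler_wpM2l// mulr_ge0// ltW.
split.
- apply: projection_regular_normal => //.
  apply: filterS near_s => s ys Ls.
  by have := min' x' s xx' Ls ys; rewrite lerD2r.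
- apply: graph_regular_normal; first by apply/eqP => Pxs; apply: NLPx'; rewrite Pxs.
  by apply: filterS near_x => x0 xx0; exact: min'.
Qed.

End approximate_solutions.

(** * Passage to the limit *)

Lemma normalizeZ (R : realType) (V : finHilbertType R) (a : R) (x : V) :
  0 < a -> `|a *: x|^-1 *: (a *: x) = `|x|^-1 *: x.
Proof.
move=> a0; rewrite normrZ gtr0_norm// scalerA invfM mulrAC mulVf ?gt_eqF//.
by rewrite mul1r.
Qed.

Lemma cvg0_norm_le (R : realType) (V : normedModType R) (x : V^nat) (e : R^nat) :
  e @ \oo --> (0 : R) -> (forall n, `|x n| <= e n) -> x @ \oo --> (0 : V).
Proof.
move=> e0 xe; apply: norm_cvg0; apply: (squeeze_cvgr _ (cvg_cst 0) e0).
by apply: nearW => n; rewrite normr_ge0 xe.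
Qed.

Lemma normr_cvg_cst (R : realType) (V : normedModType R) (x : V^nat) (l : V)
    (c : R) :
  (forall n, `|x n| = c) -> x @ \oo --> l -> `|l| = c.
Proof.
move=> xc /cvg_norm; rewrite (_ : (fun _ => _) = cst c); last exact/funext.
by move=> /(cvg_lim (@Rhausdorff R)) <-; rewrite lim_cst.
Qed.

Theorem theorem3p1 (R : realType) (X Y : finHilbertType R) (P : X -> Y)
    (Lambda : set Y) (xbar : X) :
  continuous P ->
  Lambda (P xbar) ->
  closed_near Lambda (P xbar) ->
  wscms P Lambda xbar ->
  metrically_subregular P Lambda xbar.
Proof.
move=> cP LP cL wsc; apply: contrapT => nsub.
have crit k := @approximate_critical_point _ _ _ P Lambda xbar k.+1%:R^-1 cP LP cL.
have /choice[xs /choice[ss /choice[etas all_crit]]] k :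
    exists x' s' eta, let zeta := `|P x' - s'|^-1 *: (P x' - s') in
    [/\ `|x' - xbar| < k.+1%:R^-1, ~ Lambda (P x'),
      `|P x' - s'| <= k.+1%:R^-1 * `|x' - xbar|, `|eta| <= k.+1%:R^-1 &
      regular_normal_cone Lambda s' zeta /\
      regular_normal_cone (gph P) ((x', P x') : hprod X Y)
        ((eta, - zeta) : hprod X Y)].
  by apply: crit => //; rewrite invr_gt0.
pose w k := P (xs k) - ss k.
pose zeta k := `|w k|^-1 *: w k.
pose p k : hprod X Y := (xs k - xbar, P (xs k) - P xbar).
pose t k := `|p k|.
have xs_near k : `|xs k - xbar| < k.+1%:R^-1 by case: (all_crit k).
have notL k : ~ Lambda (P (xs k)) by case: (all_crit k).
have w_small k : `|w k| <= k.+1%:R^-1 * `|xs k - xbar| by case: (all_crit k).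
have etas_small k : `|etas k| <= k.+1%:R^-1 by case: (all_crit k).
have N_Lambda k : regular_normal_cone Lambda (ss k) (zeta k).
  by case: (all_crit k) => _ _ _ _ [].
have N_gph k : regular_normal_cone (gph P) ((xs k, P (xs k)) : hprod X Y)
    ((etas k, - zeta k) : hprod X Y).
  by case: (all_crit k) => _ _ _ _ [].
have w0 k : w k != 0.
  rewrite subr_eq0; apply/eqP => Pss; apply: (notL k).
  by rewrite Pss; case: (N_Lambda k).
have t_ge k : `|xs k - xbar| <= t k := hprod_normr1 (p k).
have t0 k : 0 < t k.
  apply: lt_le_trans (t_ge k); rewrite normr_gt0 subr_eq0.
  by apply/eqP => xsk; apply: (notL k); rewrite xsk.
have inv_cvg0 : (fun k => k.+1%:R^-1 : R) @ \oo --> (0 : R) := cvg_harmonic.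
have xs_cvg : xs @ \oo --> xbar.
  by apply/subr_cvg0; apply: (cvg0_norm_le inv_cvg0) => k; exact: ltW.
have t_cvg0 : t @ \oo --> (0 : R).
  rewrite -(normr0 (hprod X Y)); apply: cvg_norm.
  apply: cvg_hprod; first by apply/subr_cvg0.
  by apply/subr_cvg0; apply: continuous_cvg => //; exact: cP.
have dir_unit k : `|(t k)^-1 *: p k| = 1.
  by apply: normr_normalize; rewrite -normr_gt0; exact: t0.
pose q k : hprod (hprod X Y) Y := ((t k)^-1 *: p k, zeta k).
have [|f [[[u xi] z] [f_ge q_cvg]]] := @finHilbert_subsequence _ _ q 2.
  move=> k; rewrite (le_trans (hprod_normr_le _))//=.
  by rewrite dir_unit normr_normalize.
have f_oo : f @ \oo --> \oo.
  by move=> A [N _ NA]; exists N => // n Nn; apply: NA; exact: leq_trans (f_ge n).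
have dir_cvg : (fun n => (t (f n))^-1 *: p (f n)) @ \oo --> ((u, xi) : hprod X Y).
  exact: cvg_hprod1 q_cvg.
have u_cvg : (fun n => (t (f n))^-1 *: (xs (f n) - xbar)) @ \oo --> u.
  exact: cvg_hprod1 dir_cvg.
have xi_cvg : (fun n => (t (f n))^-1 *: (P (xs (f n)) - P xbar)) @ \oo --> xi.
  exact: cvg_hprod2 dir_cvg.
have zeta_cvg : zeta \o f @ \oo --> z by exact: cvg_hprod2 q_cvg.
(* This [v] solves [P (xs (f n)) - t (f n) *: v n = ss (f n)]. It tends to 0 because the residual is
   at most [t] times a null sequence. *)
pose v n := (t (f n))^-1 *: w (f n).
have v_cvg : v @ \oo --> (0 : Y).
  apply: (cvg0_norm_le (cvg_comp _ _ f_oo inv_cvg0)) => n.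
  rewrite normrZ gtr0_norm ?invr_gt0//=.
  by rewrite ler_pdivrMl// mulrC (le_trans (w_small _))// ler_wpM2l.
have tf_down : downto0 (t \o f).
  by split => [n|]; [exact: t0|exact: cvg_comp t_cvg0].
have scaleK n (V : lmodType R) (y d : V) :
    y + t (f n) *: ((t (f n))^-1 *: (d - y)) = d.
  by rewrite scalerA divff ?gt_eqF// scale1r addrC subrK.
have s_eq n : P (xs (f n)) - t (f n) *: v n = ss (f n).
  by rewrite scalerA divff ?gt_eqF// scale1r /w subKr.
have s_dir n :
    P xbar + t (f n) *: ((t (f n))^-1 *: (P (xs (f n)) - P xbar) - v n) = ss (f n).
  by rewrite scalerBr addrA scaleK s_eq.
(* Subtracting [v] turns the quotients of [P] into quotients of points of [Lambda] with the same
   limit, so [xi] is tangent to [Lambda]. *)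
have s_cvg :
    (fun n => (t (f n))^-1 *: (P (xs (f n)) - P xbar) - v n) @ \oo --> xi.
  by rewrite -(subr0 xi); apply: cvgB.
apply: (wsc u xi).
(* A limit of unit vectors cannot be zero. *)
- move=> [u0 xi0]; move: dir_cvg; rewrite u0 xi0.
  move=> /(normr_cvg_cst (fun n => dir_unit (f n))).
  by move/eqP; rewrite normr0 eq_sym oner_eq0.
- split => /=; exists (t \o f); last first.
    by exists (fun n => (t (f n))^-1 *: (P (xs (f n)) - P xbar) - v n);
      split => // n; rewrite /= s_dir; case: (N_Lambda (f n)).
  exists (fun n => (t (f n))^-1 *: (xs (f n) - xbar)); split => //=.
  by under eq_fun do rewrite scaleK.
exists z, (fun n => (t (f n))^-1 *: (xs (f n) - xbar)), v, (zeta \o f), (t \o f).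
split => //.
- by apply: normr_cvg_cst zeta_cvg => n; exact: normr_normalize.
- split.
    exists (t \o f), (fun n => (t (f n))^-1 *: p (f n)),
      (fun n => (etas (f n), - zeta (f n)) : hprod X Y); split => // [|n].
      apply: cvg_hprod; last exact: cvgN.
      exact: cvg0_norm_le (cvg_comp _ _ f_oo inv_cvg0) _.
    rewrite (scaleK n (hprod X Y) (xbar, P xbar) (xs (f n), P (xs (f n)))).
    exact: N_gph.
  exists (t \o f), (fun n => (t (f n))^-1 *: (P (xs (f n)) - P xbar) - v n),
    (zeta \o f); split => // n.
  by rewrite /= s_dir.
- by move=> n; rewrite /= scaleK s_eq.
(* Each [v n] is a positive multiple of the residual, so its normalization is [zeta (f n)] and the
   inner product is exactly 1. *)
- rewrite (_ : (fun _ => _) = cst 1); first exact: cvg_cst.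
  apply/funext => n; rewrite /= /v normalizeZ ?invr_gt0// inner_normr.
  by rewrite normr_normalize ?expr1n.
Qed.
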